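(* Let $L$ be a dcpo, $\Delta$ a signature and $\mathcal{E}$ a set of inequalities. If $F(\Sigma L)$ (with continuous map $i:\Sigma L\to F(\Sigma L)$) is the free dtop-algebra with respect to $(\Delta,\mathcal{E})$ over the Scott space $\Sigma L$, then $\widetilde{F(\Sigma L)}$, equipped with the unique Scott-continuous extensions of the operations of $F(\Sigma L)$ and the map $\eta\circ i:L\to\widetilde{F(\Sigma L)}$ where $\eta(x)={\downarrow}x$, is the free dcpo-algebra with respect to $(\Delta,\mathcal{E})$ over the dcpo $L$.
   Context: Spaces are $T_0$ with specialization order $x\sqsubseteq y$ iff $x\in\overline{\{y\}}$; a directed $D$ converges to $x$ if it meets every open neighbourhood of $x$. A directed space is a $T_0$ space in which every set $U$ such that ''for every directed $D$ and $x\in U$ with $D\to x$, $D\cap U\neq\emptyset$'' is open; $\Sigma L$ is $L$ with its Scott topology. For a directed space $X$, $\widetilde{X}$ is the d-closure of $\{{\downarrow}x:x\in X\}$ inside the dcpo $\Gamma(X)$ of nonempty closed subsets ordered by inclusion (the smallest superset closed under existing directed suprema), a dcpo (the carrier of the D-completion of $X$). An inequality over a signature $\Delta$ is a pair of terms $\langle\tau_1,\tau_2\rangle$ over variables; it holds in an ordered algebra if every instance satisfies $\overline{h}(\tau_1)\leq\overline{h}(\tau_2)$. A dtop-algebra w.r.t. $(\Delta,\mathcal{E})$ is a $\Delta$-algebra on a directed space with separately continuous operations satisfying $\mathcal{E}$ in the specialization order; the free dtop-algebra over a directed space $X$ is such an algebra $A$ with continuous $i:X\to A$ such that every continuous $f:X\to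 B$ into such an algebra extends uniquely to a continuous homomorphism $\overline{f}$ with $\overline{f}\circ i=f$. A dcpo-algebra w.r.t. $(\Delta,\mathcal{E})$ is a $\Delta$-algebra on a dcpo with Scott-continuous operations satisfying $\mathcal{E}$; the free dcpo-algebra over a dcpo $L$ is such an algebra $A$ with Scott-continuous $j:L\to A$ such that every Scott-continuous $f:L\to B$ into a dcpo-algebra $B$ w.r.t. $(\Delta,\mathcal{E})$ extends uniquely to a Scott-continuous homomorphism $\overline{f}:A\to B$ with $\overline{f}\circ j=f$. *)

(* Defs.v *)
From HB Require Import structures.
From mathcomp Require Import all_boot all_order.
From mathcomp Require Import all_classical topology.

Set Implicit Arguments.
Unset Strict Implicit.
Unset Printing Implicit Defensive.

Import Order.TTheory.
Local Open Scope classical_set_scope.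
Local Open Scope order_scope.

Definition directed (T : Type) (R : T -> T -> Prop) (D : set T) : Prop :=
  D !=set0 /\
  forall x y, D x -> D y -> exists z, [/\ D z, R x z & R y z].

Definition ple (d : Order.disp_t) (P : porderType d) (x y : P) : Prop := x <= y.

Definition dcpo (d : Order.disp_t) (P : porderType d) : Prop :=
  forall D : set P, directed (@ple d P) D -> exists x, supremums D x.

Definition scott_continuous (d d' : Order.disp_t) (P : porderType d)
    (Q : porderType d') (f : P -> Q) : Prop :=
  {homo f : x y / x <= y} /\
  forall (D : set P) (x : P), directed (@ple d P) D ->
    supremums D x -> supremums (f @` D) (f x).

Definition d_closed (d : Order.disp_t) (P : porderType d) (S : set P) : Prop :=
  forall (D : set P) (x : P), D `<=` S -> directed (@ple d P) D ->
    supremums D x -> S x.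

Definition d_closure (d : Order.disp_t) (P : porderType d) (S : set P) : set P :=
  smallest (@d_closed d P) S.

Definition scott_open (d : Order.disp_t) (P : porderType d) (U : set P) : Prop :=
  (forall x y : P, x <= y -> U x -> U y) /\
  forall (D : set P) (x : P), directed (@ple d P) D ->
    supremums D x -> U x -> D `&` U !=set0.

(* The type of points of a poset P, carrying the Scott topology of P. *)
Definition scott (d : Order.disp_t) (P : porderType d) : Type := P.

Section ScottTopology.
Context {d : Order.disp_t} (P : porderType d).

Lemma scott_openT : scott_open (@setT P).
Proof. by split=> // D x [[y Dy] _] _ _; exists y. Qed.

Lemma scott_openI : setI_closed (@scott_open d P).
Proof.
move=> U V [Uup Usup] [Vup Vsup]; split=> [x y xy [Ux Vx]|D x dD Dx [Ux Vx]].
  by split; [exact: Uup Ux|exact: Vup Vx].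
have [y [Dy Uy]] := Usup _ _ dD Dx Ux.
have [z [Dz Vz]] := Vsup _ _ dD Dx Vx.
have [w [Dw yw zw]] := dD.2 _ _ Dy Dz.
by exists w; split=> //; split; [exact: Uup Uy|exact: Vup Vz].
Qed.

Lemma scott_open_bigU (I : Type) (f : I -> set P) :
  (forall i, scott_open (f i)) -> scott_open (\bigcup_i f i).
Proof.
move=> fo; split=> [x y xy [i _ fx]|D x dD Dx [i _ fx]].
  by exists i => //; exact: (fo i).1 fx.
by have [y [Dy fy]] := (fo i).2 _ _ dD Dx fx; exists y; split=> //; exists i.
Qed.

HB.instance Definition _ := Choice.on (scott P).
HB.instance Definition _ := isOpenTopological.Build (scott P)
  scott_openT scott_openI scott_open_bigU.

End ScottTopology.

Definition specialization (X : topologicalType) (x y : X) : Prop :=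
  closure [set y] x.

Definition dconverges (X : topologicalType) (D : set X) (x : X) : Prop :=
  forall U : set X, open U -> U x -> D `&` U !=set0.

Definition directed_space (X : topologicalType) : Prop :=
  kolmogorov_space X /\
  forall U : set X,
    (forall (D : set X) (x : X), directed (@specialization X) D -> U x ->
       dconverges D x -> D `&` U !=set0) ->
    open U.

(* Nonempty closed subsets of X, ordered by inclusion. *)
Definition Gamma (X : topologicalType) : Type :=
  set_type [set A : set X | closed A /\ A !=set0].

Section Gamma.
Context (X : topologicalType).
HB.instance Definition _ := SubChoice.on (Gamma X).
HB.instance Definition _ :=
  [SubChoice_isSubPOrder of Gamma X by <: with Order.default_display].

Lemma downset_subproof (x : X) :
  closure [set x] \in [set A : set X | closed A /\ A !=set0].
Proof.
apply/mem_set; split; first exact: closed_closure.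
by exists x; exact: subset_closure.
Qed.

(* The down-set of x in the specialization order is the closure of {x}. *)
Definition downset (x : X) : Gamma X := SigSub (downset_subproof x).

Definition D_completion : Type := set_type (d_closure (range downset)).
HB.instance Definition _ := SubChoice.on D_completion.
HB.instance Definition _ :=
  [SubChoice_isSubPOrder of D_completion by <: with Order.default_display].

Lemma eta_subproof (x : X) : downset x \in d_closure (range downset).
Proof. by apply/mem_set; apply: sub_gen_smallest; exists x. Qed.

Definition eta_map (x : X) : D_completion := SigSub (eta_subproof x).

End Gamma.

Record signature := Signature {
  op_symbol :> Type;
  arity : op_symbol -> nat
}.

Inductive term (Delta : signature) : Type :=
| Var of nat
| App (o : Delta) of ('I_(arity o) -> term Delta).

Definition inequality (Delta : signature) : Type := (term Delta * term Delta)%type.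

Definition operations (Delta : signature) (A : Type) : Type :=
  forall o : Delta, ('I_(arity o) -> A) -> A.

Fixpoint term_eval (Delta : signature) (A : Type) (ops : operations Delta A)
    (h : nat -> A) (t : term Delta) : A :=
  match t with
  | Var n => h n
  | App o ts => ops o (fun k => term_eval ops h (ts k))
  end.

Definition satisfies (Delta : signature) (A : Type) (R : A -> A -> Prop)
    (ops : operations Delta A) (E : set (inequality Delta)) : Prop :=
  forall p, E p -> forall h : nat -> A,
    R (term_eval ops h p.1) (term_eval ops h p.2).

Definition homomorphism (Delta : signature) (A B : Type)
    (opsA : operations Delta A) (opsB : operations Delta B) (g : A -> B) : Prop :=
  forall (o : Delta) (t : 'I_(arity o) -> A),
    g (opsA o t) = opsB o (fun k => g (t k)).

Definition separately_continuous (n : nat) (X : topologicalType)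
    (f : ('I_n -> X) -> X) : Prop :=
  forall (t : 'I_n -> X) (k : 'I_n), continuous (fun x : X => f (dfwith t k x)).

Definition dtop_algebra (Delta : signature) (E : set (inequality Delta))
    (A : topologicalType) (ops : operations Delta A) : Prop :=
  [/\ directed_space A,
      forall o : Delta, separately_continuous (ops o) &
      satisfies (@specialization A) ops E].

Definition free_dtop_algebra (Delta : signature) (E : set (inequality Delta))
    (X A : topologicalType) (ops : operations Delta A) (i : X -> A) : Prop :=
  [/\ dtop_algebra E ops, continuous i &
      forall (B : topologicalType) (opsB : operations Delta B) (f : X -> B),
        dtop_algebra E opsB -> continuous f ->
        exists! g : A -> B,
          [/\ continuous g, homomorphism ops opsB g & g \o i = f]].

(* Scott continuity of an operation refers to the pointwise order on
   'I_(arity o) -> A, i.e. to the product dcpo. *)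
Definition scott_continuous_operations (Delta : signature) (d : Order.disp_t)
    (A : porderType d) (ops : operations Delta A) : Prop :=
  forall o : Delta, scott_continuous (ops o).

Definition dcpo_algebra (Delta : signature) (E : set (inequality Delta))
    (d : Order.disp_t) (A : porderType d) (ops : operations Delta A) : Prop :=
  [/\ dcpo A, scott_continuous_operations ops & satisfies (@ple d A) ops E].

Definition free_dcpo_algebra (Delta : signature) (E : set (inequality Delta))
    (d d' : Order.disp_t) (L : porderType d) (A : porderType d')
    (ops : operations Delta A) (j : L -> A) : Prop :=
  [/\ dcpo_algebra E ops, scott_continuous j &
      forall (d'' : Order.disp_t) (B : porderType d'')
        (opsB : operations Delta B) (f : L -> B),
        dcpo_algebra E opsB -> scott_continuous f ->
        exists! g : A -> B,
          [/\ scott_continuous g, homomorphism ops opsB g & g \o j = f]].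

Definition scott_continuous_extension (Delta : signature) (X : topologicalType)
    (ops : operations Delta X) (opsT : operations Delta (D_completion X)) : Prop :=
  scott_continuous_operations opsT /\ homomorphism ops opsT (@eta_map X).

(* Main.v *)
Require Import Defs.
From HB Require Import structures.
From mathcomp Require Import all_boot all_order.
From mathcomp Require Import all_classical topology.

Set Implicit Arguments.
Unset Strict Implicit.
Unset Printing Implicit Defensive.

Import Order.TTheory.
Local Open Scope classical_set_scope.
Local Open Scope order_scope.

(** A continuous map [f] from a space [X] to the Scott space of a dcpo extends
    uniquely to the D-completion of [X], by sending a closed set [A] to the
    supremum of [f A]: the closed sets for which this supremum exists form a
    d-closed family containing all principal down-sets. Likewise a separately
    continuous operation lifts by sending [(A_1, ..., A_n)] to the closure of the
    image of [A_1 * ... * A_n]; this is Scott continuous in each argument, hence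
    jointly. Equalities and inequalities between Scott-continuous maps cut out
    d-closed sets, so they propagate from the principal down-sets to the whole
    completion, one argument at a time.

    Finally, the Scott space of a dcpo-algebra [B] is a dtop-algebra, so a
    Scott-continuous map [L -> B] extends to [F] by freeness and then to the
    D-completion of [F]. *)

(** * Scott-continuous maps and the d-closed sets they define *)

Section ScottContinuity.
Context {d d' : Order.disp_t} (P : porderType d) (Q : porderType d').

Lemma directed_image (f : P -> Q) (D : set P) : {homo f : x y / x <= y} ->
  directed (@ple d P) D -> directed (@ple d' Q) (f @` D).
Proof.
move=> fh [[x Dx] dD]; split; first by exists (f x), x.
move=> _ _ [y Dy <-] [z Dz <-]; have [w [Dw yw zw]] := dD _ _ Dy Dz.
by exists (f w); split; [exists w|exact: fh|exact: fh].
Qed.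

Lemma supremums_unique (D : set P) x y :
  supremums D x -> supremums D y -> x = y.
Proof.
move=> [ux lx] [uy ly]; apply/eqP; rewrite eq_le.
by rewrite (lx _ uy) (ly _ ux).
Qed.

Lemma scott_continuous_cst (q : Q) : scott_continuous (fun _ : P => q).
Proof.
split=> [x y //|D x [[y Dy] _] _]; split=> [_ [z _ <-] //|z uz].
by apply: uz; exists y.
Qed.

Lemma scott_continuous_id : scott_continuous (@id P).
Proof. by split=> // D x _ Dx; rewrite image_id. Qed.

Lemma scott_continuous_comp (d'' : Order.disp_t) (R : porderType d'')
    (g : Q -> R) (f : P -> Q) :
  scott_continuous g -> scott_continuous f -> scott_continuous (g \o f).
Proof.
move=> [gh gs] [fh fs]; split=> [x y xy|D x dD Dx]; first exact/gh/fh.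
by rewrite -image_comp; apply: gs (directed_image fh dD) (fs _ _ dD Dx).
Qed.

(** For a supremum [x] of [D], every [y] in [D] gives [f y <= g y <= g x], so [g x] bounds the image
    of [D] under [f], and [f x] is its least bound. *)
Lemma d_closed_le (f g : P -> Q) : scott_continuous f -> scott_continuous g ->
  d_closed [set x | f x <= g x].
Proof.
move=> [_ fs] [gh gs] D x DS dD Dx; apply: (fs _ _ dD Dx).2 => _ [y Dy <-].
by apply: le_trans (DS _ Dy) _; apply/gh/Dx.1.
Qed.

Lemma d_closed_eq (f g : P -> Q) : scott_continuous f -> scott_continuous g ->
  d_closed [set x | f x = g x].
Proof.
move=> fc gc D x DS dD Dx; apply/eqP; rewrite eq_le; apply/andP; split.
  by apply: (d_closed_le fc gc _ dD Dx) => y /DS /= ->.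
by apply: (d_closed_le gc fc _ dD Dx) => y /DS /= ->.
Qed.

Lemma scott_continuous_pointwise (I : Type) (f : I -> P -> Q) :
  (forall k, scott_continuous (f k)) ->
  scott_continuous (fun x : P => (fun k => f k x) : I -> Q).
Proof.
move=> fc; split=> [x y xy|D x dD Dx]; first by apply/lefP => k; exact: (fc k).1.
split=> [_ [y Dy <-]|u uu]; apply/lefP => k.
  by apply: (fc k).1; exact: Dx.1.
apply: ((fc k).2 _ _ dD Dx).2 => _ [y Dy <-].
by have /lefP := uu _ (ex_intro2 _ _ y Dy erefl).
Qed.

Lemma scott_continuous_preimage (f : P -> Q) (U : set Q) :
  scott_continuous f -> scott_open U -> scott_open (f @^-1` U).
Proof.
move=> [fh fs] [Uup Us]; split=> [x y xy|D x dD Dx Ux].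
  by apply: Uup; exact: fh.
have [_ [[y Dy <-] Uy]] := Us _ _ (directed_image fh dD) (fs _ _ dD Dx) Ux.
by exists y.
Qed.

End ScottContinuity.

(** * Tuples modified in one coordinate; joint Scott continuity from separate *)

Lemma dfwith_id (I : eqType) (T : Type) (t : I -> T) k : dfwith t k (t k) = t.
Proof. by apply/funext => j; case: dfwithP. Qed.

Lemma comp_dfwith (I : eqType) (T U : Type) (f : T -> U) (t : I -> T) k x :
  (fun j => f (dfwith t k x j)) = dfwith (fun j => f (t j)) k (f x).
Proof.
apply/funext => j; case: dfwithP => [|i ki]; first by rewrite dfwithin.
by rewrite dfwithout.
Qed.

Section JointScottContinuity.
Context {d d' : Order.disp_t} (P : porderType d) (Q : porderType d').

Lemma scott_continuous_dfwith (I : eqType) (t : I -> P) (k : I) :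
  scott_continuous (fun x : P => (dfwith t k x : I -> P)).
Proof.
apply: (@scott_continuous_pointwise _ _ _ _ _ (fun j x => dfwith t k x j)) => j.
have [->|kj] := eqVneq k j.
  have -> : (fun x => dfwith t j x j) = id by apply/funext => x; rewrite dfwithin.
  exact: scott_continuous_id.
have -> : (fun x => dfwith t k x j) = cst (t j).
  by apply/funext => x; rewrite dfwithout.
exact: scott_continuous_cst.
Qed.

(** Replacing coordinate [k] of [x] by an upper bound [y] of the projections still bounds [D], so
    [x] lies below the modified tuple. *)
Lemma supremums_proj (I : eqType) (D : set (I -> P)) x (k : I) :
  supremums D x -> supremums ((fun t => t k) @` D) (x k).
Proof.
move=> [ux lx]; split=> [_ [t Dt <-]|y uy]; first by have /lefP := ux _ Dt.
suff /lx/lefP/(_ k) : ubound D (dfwith x k y) by rewrite dfwithin.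
move=> t Dt; apply/lefP => j; case: dfwithP => [|i _].
  by apply: uy; exists t.
by have /lefP := ux _ Dt.
Qed.

(** Monotonicity: pass from one tuple to the other one coordinate at a time. Suprema: replace the
    coordinates of [x] successively by those of elements of [D]; [I] is finite, and directedness
    supplies a common bound. *)
Lemma scott_continuous_joint (I : finType) (f : (I -> P) -> Q) :
  (forall t k, scott_continuous (fun x => f (dfwith t k x))) ->
  scott_continuous f.
Proof.
move=> fc.
have fh : {homo f : x y / x <= y}.
  move=> t t' tt'; have : forall k, k \notin enum I -> t k = t' k.
    by move=> k; rewrite mem_enum.
  elim: (enum I) t tt' => [t _ tt'|a s IH t /lefP tt' ts].
    by rewrite (_ : t = t')//; apply/funext => k; exact: tt'.
  apply: (@le_trans _ _ (f (dfwith t a (t' a)))).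
    by rewrite -{1}(dfwith_id t a); apply: (fc t a).1; exact: tt'.
  apply: IH => [|k ks]; first by apply/lefP => k; case: dfwithP.
  by case: dfwithP ks => // j aj js; apply: ts; rewrite inE negb_or eq_sym aj.
split=> // D x dD Dx; split=> [_ [t Dt <-]|u uu]; first by apply/fh/Dx.1.
have xD t : D t -> forall k, t k <= x k by move=> Dt; apply/lefP/Dx.1.
(* The list [s] holds the coordinates where [t] need not lie below [e]. The full list allows
   [t = x]; the empty list gives [f t <= f e <= u]. *)
suff H (s : seq I) t : (forall k, t k <= x k) ->
    (exists2 e, D e & forall k, k \notin s -> t k <= e k) -> f t <= u.
  apply: (H (enum I)) => //; have [e De] := dD.1.
  by exists e => // k; rewrite mem_enum.
elim: s t => [|a s IH] t tx [e De te].
  apply: (@le_trans _ _ (f e)); last by apply: uu; exists e.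
  by apply/fh/lefP => k; exact: te.
have dDa := directed_image (f := fun t => t a) (fun x y xy => lefP _ _ xy a) dD.
have [_] := (fc t a).2 _ _ dDa (supremums_proj a Dx).
move=> /(_ u) H; apply: (@le_trans _ _ (f (dfwith t a (x a)))).
  by apply/fh/lefP => k; case: dfwithP.
apply: H => _ [_ [e' De' <-] <-].
(* [w] dominates both the old witness [e] and the element [e'] supplying coordinate [a], so [a] can
   leave the list. *)
have [w [Dw /lefP ew /lefP e'w]] := dD.2 _ _ De De'.
apply: IH => [k|]; first by case: dfwithP => // ; exact: xD.
exists w => // k; case: dfwithP => // j aj js.
by apply: le_trans (ew j); apply: te; rewrite inE negb_or eq_sym aj.
Qed.

End JointScottContinuity.

(** * Closure and the specialization order *)

Section Specialization.
Context (X : topologicalType).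

Lemma closure_min (A B : set X) : closed B -> A `<=` B -> closure A `<=` B.
Proof. by move=> cB AB; rewrite closureE; apply: smallest_sub. Qed.

Lemma closure_openP (A : set X) x :
  closure A x <-> forall U, open U -> U x -> A `&` U !=set0.
Proof.
split=> [cx U oU Ux|H B /=]; first by apply: cx; exact: open_nbhs_nbhs.
rewrite nbhsE => -[U [oU Ux] UB]; have [y [Ay Uy]] := H _ oU Ux.
by exists y; split=> //; exact: UB.
Qed.

Lemma specializationP (x y : X) :
  specialization x y <-> forall U, open U -> U x -> U y.
Proof.
split=> [/closure_openP H U oU Ux|H].
  by have [_ [-> Uy]] := H _ oU Ux.
by apply/closure_openP => U oU Ux; exists y; split=> //; exact: H Ux.
Qed.

Lemma specialization_refl (x : X) : specialization x x.
Proof. exact: subset_closure. Qed.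

Lemma specialization_trans (x y z : X) :
  specialization x y -> specialization y z -> specialization x z.
Proof.
move=> /specializationP xy /specializationP yz.
by apply/specializationP => U oU /xy/yz; exact.
Qed.

End Specialization.

Lemma continuous_specialization (X Y : topologicalType) (f : X -> Y) (x y : X) :
  continuous f -> specialization x y -> specialization (f x) (f y).
Proof.
move=> /continuousP fc /specializationP xy; apply/specializationP => U oU Ux.
exact: (xy (f @^-1` U) (fc _ oU)).
Qed.

(** The preimage of [C] is closed and contains [A], hence its closure. This carries bounds checked
    on a union over to the closure of that union. *)
Lemma image_closure_subset (X Y : topologicalType) (f : X -> Y) (A : set X)
    (C : set Y) : continuous f -> closed C -> f @` A `<=` C ->
  f @` closure A `<=` C.
Proof.
move=> fc cC AC _ [x Ax <-]; move: x Ax; apply: closure_min.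
  by apply: preimage_closed => // x _; exact: fc.
by move=> x Ax; apply: AC; exists x.
Qed.

(** * Scott spaces as directed spaces *)

Section ScottSpace.
Context {d : Order.disp_t} (P : porderType d).

Lemma scott_closed_down (p : P) : closed [set x : scott P | (x : P) <= p].
Proof.
rewrite -openC; split=> [x y xy xp yp|D x dD Dx xp].
  by apply: xp; exact: le_trans yp.
apply: contrapT => DU; apply: xp; apply: Dx.2 => y Dy.
by apply: contrapT => yp; apply: DU; exists y.
Qed.

Lemma scott_specialization (x y : P) :
  specialization (x : scott P) (y : scott P) <-> x <= y.
Proof.
split=> [|xy]; last first.
  by apply/specializationP => U [Uup _]; exact: Uup.
by apply: (closure_min (@scott_closed_down y)) => _ -> /=.
Qed.

Lemma scott_directed_space : directed_space (scott P).
Proof.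
split=> [x y|U HU].
  apply: contraNP => H; apply/eqP/le_anti/andP; split.
    apply/scott_specialization/specializationP => U oU Ux.
    apply: contrapT => Uy; apply: H; exists U; left; split; apply/mem_set => //.
    exact: open_nbhs_nbhs.
  apply/scott_specialization/specializationP => U oU Uy.
  apply: contrapT => Ux; apply: H; exists U; right; split; apply/mem_set => //.
  exact: open_nbhs_nbhs.
split=> [x y xy Ux|D x dD Dx Ux].
  (* For [x <= y] the singleton of [y] is directed and converges to [x]; testing [U] against it
     yields upward closure. *)
  have [|V [Vup _] Vx|z [-> //]] := HU [set y] x _ Ux.
    split; first by exists y.
    by move=> _ _ -> ->; exists y; split=> //; exact: specialization_refl.
  by exists y; split=> //; exact: Vup Vx.
apply: (HU D x) => //; last by move=> V [_ Vs]; exact: Vs.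
split=> [|y z Dy Dz]; first exact: dD.1.
have [w [Dw yw zw]] := dD.2 _ _ Dy Dz.
by exists w; split=> //; exact/scott_specialization.
Qed.

End ScottSpace.

Lemma scott_continuousP {d d' : Order.disp_t} (P : porderType d)
    (Q : porderType d') (f : P -> Q) :
  continuous (f : scott P -> scott Q) <-> scott_continuous f.
Proof.
split=> [fc|fc]; last first.
  by apply/continuousP => U; exact: scott_continuous_preimage.
have fh : {homo f : x y / x <= y}.
  move=> x y /scott_specialization.
  by move/(continuous_specialization fc)/scott_specialization.
split=> // D x dD Dx; split=> [_ [y Dy <-]|u uu]; first by apply/fh/Dx.1.
(* If [f x] were not below [u], the open complement of the down-set of [u] would have a preimage
   containing [x], hence meeting [D], although [u] bounds the image of [D]. *)
apply: contrapT => fxu.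
have oU : open (~` [set y : scott Q | (y : Q) <= u]).
  by rewrite openC; exact: scott_closed_down.
have [_ Us] := (continuousP (f : scott P -> scott Q)).1 fc _ oU.
by have [y [Dy]] := Us _ _ dD Dx fxu; apply; apply: uu; exists y.
Qed.

Lemma dcpo_dtop_algebra {d : Order.disp_t} (P : porderType d)
    (Delta : signature) (E : set (inequality Delta))
    (ops : operations Delta P) :
  dcpo_algebra E ops -> dtop_algebra E (ops : operations Delta (scott P)).
Proof.
move=> [_ opsc opsE]; split; first exact: scott_directed_space.
  move=> o t k; apply/scott_continuousP.
  exact: (scott_continuous_comp (opsc o) (scott_continuous_dfwith t k)).
by move=> p Ep h; apply/scott_specialization; exact: opsE.
Qed.

(** * The D-completion as a dcpo, and induction over it *)

Section Completion.
Context (X : topologicalType).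
Implicit Types (A B : Gamma X) (D : set (Gamma X)).

Lemma Gamma_closed A : closed (val A).
Proof. by have [] := set_mem (valP A). Qed.

Lemma Gamma_nonempty A : val A !=set0.
Proof. by have [] := set_mem (valP A). Qed.

Lemma Gamma_leP A B : A <= B <-> val A `<=` val B.
Proof. by rewrite -[A <= B]/(val A <= val B) subsetEset. Qed.

Lemma Gamma_sup_subproof D : D !=set0 ->
  closure (\bigcup_(B in D) val B) \in [set A : set X | closed A /\ A !=set0].
Proof.
move=> [A DA]; apply/mem_set; split; first exact: closed_closure.
by have [x Ax] := Gamma_nonempty A; exists x; apply: subset_closure; exists A.
Qed.

Lemma supremums_Gamma D A : D !=set0 ->
  supremums D A <-> val A = closure (\bigcup_(B in D) val B).
Proof.
move=> D0; suff H : supremums D (SigSub (Gamma_sup_subproof D0) : Gamma X).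
  split=> [DA|eA]; first by rewrite (supremums_unique DA H).
  by rewrite (_ : A = SigSub (Gamma_sup_subproof D0))//; exact/val_inj.
split=> [B DB|B uB]; apply/Gamma_leP => /=.
  by move=> x Bx; apply: subset_closure; exists B.
apply: closure_min; first exact: Gamma_closed.
by move=> x [C DC]; apply: (Gamma_leP C B).1; exact: uB.
Qed.

Lemma Gamma_has_sup D : D !=set0 -> exists A, supremums D A.
Proof.
move=> D0; exists (SigSub (Gamma_sup_subproof D0)).
exact/supremums_Gamma.
Qed.

Lemma d_closed_d_closure (S : set (Gamma X)) : d_closed (d_closure S).
Proof.
move=> D x DS dD Dx T [cT ST]; apply: (cT D) => // y /DS; apply.
by split.
Qed.

Lemma sup_mem_completion D A : D `<=` d_closure (range (@downset X)) ->
  directed (@ple _ _) D -> supremums D A ->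
  A \in d_closure (range (@downset X)).
Proof. by move=> DS dD DA; apply/mem_set; exact: d_closed_d_closure DA. Qed.

Lemma val_completion_sub (D : set (D_completion X)) :
  val @` D `<=` d_closure (range (@downset X)).
Proof. by move=> _ [C _ <-]; exact: (set_mem (valP C)). Qed.

Lemma completion_leP (A B : D_completion X) :
  A <= B <-> val (val A) `<=` val (val B).
Proof. exact: Gamma_leP. Qed.

(** The d-closure contains the supremum in [Gamma X] of each of its directed subsets, so both posets
    compute the same directed suprema. *)
Lemma supremums_completion (D : set (D_completion X)) (A : D_completion X) :
  directed (@ple _ _) D -> supremums D A <-> supremums (val @` D) (val A).
Proof.
move=> dD; have dD' : directed (@ple _ _) (val @` D) by exact: directed_image dD.
suff H (A' : D_completion X) : supremums (val @` D) (val A') -> supremums D A'.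
  split=> [DA|]; last exact: H.
  have [B DB] := Gamma_has_sup dD'.1.
  have cB := sup_mem_completion (@val_completion_sub D) dD' DB.
  by rewrite (supremums_unique DA (H (SigSub cB) DB)).
move=> [uA lA]; split=> [B DB|B uB]; first by apply: uA; exists B.
by apply: lA => _ [C DC <-]; exact: uB.
Qed.

Lemma completion_dcpo : dcpo (D_completion X).
Proof.
move=> D dD; have dD' : directed (@ple _ _) (val @` D) by exact: directed_image dD.
have [B DB] := Gamma_has_sup dD'.1.
have cB := sup_mem_completion (@val_completion_sub D) dD' DB.
by exists (SigSub cB); apply/supremums_completion.
Qed.

Lemma scott_continuous_val : scott_continuous (val : D_completion X -> Gamma X).
Proof. by split=> // D A dD /supremums_completion; exact. Qed.

Lemma scott_continuous_into_completion (d : Order.disp_t) (P : porderType d)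
    (f : P -> D_completion X) :
  scott_continuous (fun x => val (f x)) -> scott_continuous f.
Proof.
move=> [vh fs]; have fh : {homo f : x y / x <= y} by move=> x y; exact: vh.
split=> // D x dD Dx; apply/supremums_completion; first exact: directed_image.
by rewrite image_comp; exact: fs.
Qed.

(** The image of [S] in [Gamma X] is d-closed and contains all principal down-sets, so it contains
    their d-closure. *)
Lemma completion_ind (S : set (D_completion X)) : d_closed S ->
  (forall x, S (eta_map x)) -> forall A : D_completion X, S A.
Proof.
move=> cS etaS A; suff [B SB /val_inj <-//] : (val @` S) (val A).
have /set_mem := valP A; apply; split=> [D B DS dD DB|_ [x _ <-]]; last first.
  by exists (eta_map x).
have cB : B \in d_closure (range (@downset X)).
  by apply: sup_mem_completion DB => // C /DS[C' _ <-]; exact: (set_mem (valP C')).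
(* All members of [D] come from the completion, so [D] pulls back to a directed subset there, to
   which [cS] applies. *)
have DE : D = (val : D_completion X -> Gamma X) @` [set C | D (val C)].
  apply/seteqP; split=> [C DC|_ [C DC <-] //].
  by have [C' _ eC] := DS _ DC; exists C' => //=; rewrite eC.
have dD' : directed (@ple _ _) [set C : D_completion X | D (val C)].
  split=> [|C1 C2 DC1 DC2].
    by have [C DC] := dD.1; have [C' _ eC] := DS _ DC; exists C'; rewrite /= eC.
  have [C [DC C1C C2C]] := dD.2 _ _ DC1 DC2.
  by have [C' _ eC] := DS _ DC; rewrite -eC in DC C1C C2C; exists C'.
exists (SigSub cB) => //; apply: (cS _ _ _ dD'); last first.
  by apply/supremums_completion => //; move: DB; rewrite {1}DE.
by move=> C /DS[C' SC' /val_inj <-].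
Qed.

(** Coordinates outside [s] are already principal; [completion_ind] treats those in [s] one by one.
    [I] may be infinite, so the lemma also covers variable assignments indexed by [nat]. *)
Lemma completion_ind_seq (I : eqType) (S : set (I -> D_completion X)) (s : seq I) :
  (forall t : I -> X, S (fun k => eta_map (t k))) ->
  (forall t k, d_closed [set B | S (dfwith t k B)]) ->
  forall t, (forall k, k \notin s -> range (@eta_map X) (t k)) -> S t.
Proof.
move=> Seta cS; elim: s => [|a s IH] t ts.
  have /choice[u tu] : forall k, exists x, eta_map x = t k.
    by move=> k; have [|x _ <-] := ts k; [|exists x].
  by rewrite (_ : t = fun k => eta_map (u k))//; apply/funext => k; rewrite tu.
rewrite -(dfwith_id t a); apply: (completion_ind (cS t a)) => x /=.
apply: IH => k ks; case: dfwithP ks => [_|j aj js]; first by exists x.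
by apply: ts; rewrite inE negb_or eq_sym aj.
Qed.

Lemma completion_ind_fin (I : finType) (S : set (I -> D_completion X)) :
  (forall t : I -> X, S (fun k => eta_map (t k))) ->
  (forall t k, d_closed [set B | S (dfwith t k B)]) -> forall t, S t.
Proof.
move=> Seta cS t; apply: (completion_ind_seq (s := enum I) Seta cS) => k.
by rewrite mem_enum.
Qed.

Lemma eta_homo (x y : X) : specialization x y -> eta_map x <= eta_map y.
Proof.
move=> xy; apply/completion_leP; apply: closure_min; first exact: closed_closure.
by move=> _ ->.
Qed.

(** If a directed [D] converges to [x], then [x] is in the closure of [D], so [eta_map x] lies below
    the supremum of the image of [D]. A Scott-open set containing [eta_map x] therefore meets that
    image. *)
Lemma eta_continuous : directed_space X ->
  continuous (@eta_map X : X -> scott (D_completion X)).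
Proof.
move=> [_ HX]; apply/continuousP => U [Uup Us]; apply: HX => D x dD Ux Dx.
have dD' : directed (@ple _ _) (@eta_map X @` D).
  split=> [|_ _ [y Dy <-] [z Dz <-]].
    by have [y Dy] := dD.1; exists (eta_map y), y.
  have [w [Dw yw zw]] := dD.2 _ _ Dy Dz.
  by exists (eta_map w); split; [exists w|exact: eta_homo|exact: eta_homo].
have [A DA] := completion_dcpo dD'.
have [|_ [[y Dy <-] Uy]] := Us _ _ dD' DA; last by exists y.
apply: Uup Ux; apply/completion_leP; apply: closure_min; first exact: Gamma_closed.
move=> _ ->; move: ((closure_openP D x).2 Dx).
apply: closure_min; first exact: Gamma_closed.
move=> y Dy; have /completion_leP : eta_map y <= A by apply: DA.1; exists y.
by apply; exact: subset_closure.
Qed.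

End Completion.

(** * Extending continuous maps to the D-completion *)

Section Extension.
Context (X : topologicalType) {d : Order.disp_t} (P : porderType d).

Lemma supremums_image_downset (f : X -> scott P) (x : X) : continuous f ->
  supremums (f @` val (downset x) : set P) (f x).
Proof.
move=> fc; split=> [_ [y yx <-]|u uu].
  by apply/scott_specialization; exact: continuous_specialization yx.
by apply: uu; exists x => //; exact: subset_closure.
Qed.

Lemma completion_sup_image (f : X -> scott P) : dcpo P -> continuous f ->
  forall A : D_completion X, exists p : P, supremums (f @` val (val A) : set P) p.
Proof.
move=> hP fc A; have /set_mem := valP A.
move=> /(_ [set B | exists p : P, supremums (f @` val B : set P) p]); apply.
split=> [D B DS dD DB|_ [x _ <-]].
  pose s (C : Gamma X) : set P := supremums (f @` val C : set P).
  have sle C1 C2 p1 p2 : C1 <= C2 -> s C1 p1 -> s C2 p2 -> p1 <= p2.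
    move=> /Gamma_leP C12 s1 s2; apply: s1.2 => _ [x Cx <-].
    by apply: s2.1; exists x => //; exact: C12.
  (* The supremum sought for [B] is that of the suprema attached to the members of [D]; they form a
     directed set because they grow with the member. *)
  have dS : directed (@ple _ P) [set p | exists2 C, D C & s C p].
    split=> [|p1 p2 [C1 DC1 s1] [C2 DC2 s2]].
      by have [C DC] := dD.1; have [p sp] := DS _ DC; exists p, C.
    have [C [DC C1C C2C]] := dD.2 _ _ DC1 DC2; have [p sp] := DS _ DC.
    exists p; split; first by exists C.
    - exact: sle s1 sp.
    - exact: sle s2 sp.
  have [p [up lp]] := hP _ dS; exists p.
  have -> := (supremums_Gamma B dD.1).1 DB.
  split=> [|q uq].
    apply: (image_closure_subset (C := [set y : scott P | (y : P) <= p])) => //.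
      exact: scott_closed_down.
    move=> _ [x [C DC Cx] <-] /=; have [q sq] := DS _ DC.
    apply: (@le_trans _ _ q); first by apply: sq.1; exists x.
    by apply: up; exists C.
  apply: lp => q' [C DC sq']; apply: sq'.2 => _ [x Cx <-].
  by apply: uq; exists x => //; apply: subset_closure; exists C.
by exists (f x); exact: supremums_image_downset.
Qed.

Lemma completion_extension (f : X -> scott P) : dcpo P -> continuous f ->
  exists2 g : D_completion X -> P,
    scott_continuous g & forall x, g (eta_map x) = f x.
Proof.
move=> hP fc; have /choice[g gs] := completion_sup_image hP fc.
have gh : {homo g : A B / A <= B}.
  move=> A B /completion_leP AB; apply: (gs A).2 => _ [x Ax <-].
  by apply: (gs B).1; exists x => //; exact: AB.
exists g => [|x]; last first.
  by apply/supremums_unique; [exact: gs|exact: supremums_image_downset].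
split=> // D A dD DA; split=> [_ [B DB <-]|u uu]; first by apply/gh/DA.1.
apply: (gs A).2.
have /supremums_Gamma -> := (supremums_completion A dD).1 DA; last first.
  by have [B DB] := dD.1; exists (val B), B.
apply: (image_closure_subset (C := [set y : scott P | (y : P) <= u])) => //.
  exact: scott_closed_down.
move=> _ [x [_ [B DB <-] Bx] <-] /=.
apply: (@le_trans _ _ (g B)); first by apply: (gs B).1; exists x.
by apply: uu; exists B.
Qed.

Lemma completion_extension_unique (g g' : D_completion X -> P) :
  scott_continuous g -> scott_continuous g' ->
  (forall x, g (eta_map x) = g' (eta_map x)) -> g = g'.
Proof.
move=> gc gc' gg'; apply/funext => A; move: A; apply: completion_ind => //.
exact: d_closed_eq.
Qed.

(** Equality spreads from tuples of principal down-sets one coordinate at a time, each coordinate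
    giving a d-closed equalizer. *)
Lemma completion_extension_unique_fin (I : finType)
    (g g' : (I -> D_completion X) -> P) :
  (forall t k, scott_continuous (fun B => g (dfwith t k B))) ->
  (forall t k, scott_continuous (fun B => g' (dfwith t k B))) ->
  (forall t : I -> X, g (fun k => eta_map (t k)) = g' (fun k => eta_map (t k))) ->
  g = g'.
Proof.
move=> gc gc' gg'; apply/funext => t; move: t.
apply: (completion_ind_fin (S := [set t | g t = g' t])) => // t k.
exact: (d_closed_eq (gc t k) (gc' t k)).
Qed.

End Extension.

(** * Lifting separately continuous operations *)

Section LiftOperation.
Context (X : topologicalType) (n : nat) (f : ('I_n -> X) -> X).
Context (fc : separately_continuous f).

(** Continuity in one coordinate handles one change; transitivity chains the finitely many
    changes. *)
Lemma separately_continuous_specialization (t t' : 'I_n -> X) :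
  (forall k, specialization (t k) (t' k)) -> specialization (f t) (f t').
Proof.
move=> tt'; have : forall k, k \notin enum 'I_n -> t k = t' k.
  by move=> k; rewrite mem_enum.
elim: (enum 'I_n) t tt' => [t _ tt'|a s IH t tt' ts].
  have -> : t = t' by apply/funext => k; exact: tt'.
  exact: specialization_refl.
apply: (@specialization_trans _ _ (f (dfwith t a (t' a)))).
  rewrite -{1}(dfwith_id t a).
  exact: (continuous_specialization (@fc t a) (tt' a)).
apply: IH => [k|k ks]; first by case: dfwithP => //; exact: specialization_refl.
by case: dfwithP ks => // j aj js; apply: ts; rewrite inE negb_or eq_sym aj.
Qed.

Definition box_image (A : 'I_n -> Gamma X) : set X :=
  f @` [set t | forall k, val (A k) (t k)].

Lemma box_image_subproof (A : 'I_n -> Gamma X) :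
  closure (box_image A) \in [set A : set X | closed A /\ A !=set0].
Proof.
apply/mem_set; split; first exact: closed_closure.
have /choice[t At] : forall k, exists x, val (A k) x.
  by move=> k; exact: Gamma_nonempty.
by exists (f t); apply: subset_closure; exists t.
Qed.

Definition lift_Gamma (A : 'I_n -> Gamma X) : Gamma X :=
  SigSub (box_image_subproof A).

Lemma scott_continuous_lift_Gamma (A : 'I_n -> Gamma X) (k : 'I_n) :
  scott_continuous (fun B => lift_Gamma (dfwith A k B)).
Proof.
have lh : {homo (fun B => lift_Gamma (dfwith A k B)) : B C / B <= C}.
  move=> B C /Gamma_leP BC; apply/Gamma_leP; apply: closure_subset.
  move=> _ [t Bt <-]; exists t => // j; move: (Bt j).
  by case: dfwithP => [|i ki]; [rewrite dfwithin; exact: BC|rewrite dfwithout].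
split=> // D B dD DB; split=> [_ [C DC <-]|U uU]; first by apply/lh/DB.1.
apply/Gamma_leP; apply: closure_min; first exact: Gamma_closed.
(* With the other coordinates frozen, [t k] lies in the closure of the union of [D]; continuity in
   coordinate [k] reduces the claim to points of members of [D]. *)
move=> _ [t Bt <-]; rewrite -(dfwith_id t k).
have := Bt k; rewrite dfwithin (supremums_Gamma B dD.1).1// => tk.
suff : (fun x => f (dfwith t k x)) @` closure (\bigcup_(C in D) val C) `<=` val U.
  by apply; exists (t k).
apply: image_closure_subset; [exact: fc|exact: Gamma_closed|].
move=> _ [x [C DC Cx] <-].
have /Gamma_leP : lift_Gamma (dfwith A k C) <= U by apply: uU; exists C.
apply; apply: subset_closure; exists (dfwith t k x) => // j.
case: dfwithP => [|i ki]; first by rewrite dfwithin.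
by have := Bt i; rewrite !dfwithout.
Qed.

(** The operation preserves specialization, so [f t] dominates the image of the box; conversely [t]
    itself lies in the box. *)
Lemma lift_Gamma_downset (t : 'I_n -> X) :
  lift_Gamma (fun k => downset (t k)) = downset (f t).
Proof.
apply/val_inj/seteqP; split=> /=.
  apply: closure_min; first exact: closed_closure.
  by move=> _ [u ut <-]; exact: separately_continuous_specialization.
apply: closure_subset => _ ->; exists t => // k; exact: specialization_refl.
Qed.

Lemma scott_continuous_lift_val (t : 'I_n -> D_completion X) (k : 'I_n) :
  scott_continuous (fun B => lift_Gamma (fun j => val (dfwith t k B j))).
Proof.
have -> : (fun B => lift_Gamma (fun j => val (dfwith t k B j))) =
    (fun B => lift_Gamma (dfwith (fun j => val (t j)) k B)) \o val.
  by apply/funext => B /=; rewrite comp_dfwith.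
apply: scott_continuous_comp (@scott_continuous_val X).
exact: scott_continuous_lift_Gamma.
Qed.

(** Tuples whose lift stays in the d-closure include those of principal down-sets and form a
    d-closed set in each coordinate. *)
Lemma lift_subproof (t : 'I_n -> D_completion X) :
  lift_Gamma (fun k => val (t k)) \in d_closure (range (@downset X)).
Proof.
apply/mem_set; move: t.
apply: (completion_ind_fin
  (S := [set t | d_closure _ (lift_Gamma (fun k => val (t k)))])).
  move=> t /=; rewrite lift_Gamma_downset; apply: sub_gen_smallest.
  by exists (f t).
move=> t k D B DS dD DB; have [lh ls] := scott_continuous_lift_val t k.
apply: (d_closed_d_closure _ (directed_image lh dD) (ls _ _ dD DB)).
by move=> _ [C DC <-]; exact: DS.
Qed.

Definition lift_operation (t : 'I_n -> D_completion X) : D_completion X :=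
  SigSub (lift_subproof t).

Lemma scott_continuous_lift_operation : scott_continuous lift_operation.
Proof.
apply: scott_continuous_joint => t k; apply: scott_continuous_into_completion.
exact: scott_continuous_lift_val.
Qed.

Lemma lift_operation_eta (t : 'I_n -> X) :
  lift_operation (fun k => eta_map (t k)) = eta_map (f t).
Proof. by apply/val_inj; exact: lift_Gamma_downset. Qed.

End LiftOperation.

(** * Term evaluation, inequalities and homomorphisms *)

Section Terms.
Context (Delta : signature).

Lemma term_eval_homomorphism (A B : Type) (opsA : operations Delta A)
    (opsB : operations Delta B) (g : A -> B) (h : nat -> A) (t : term Delta) :
  homomorphism opsA opsB g ->
  term_eval opsB (fun n => g (h n)) t = g (term_eval opsA h t).
Proof.
move=> gh; elim: t => //= o ts IH; rewrite gh; congr (opsB o _).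
by apply/funext => k; exact: IH.
Qed.

(** At an application, [N] is the maximum of the bounds of the arguments. It is uniform in the
    algebra and leaves only finitely many variables to induct on. *)
Lemma term_eval_finite_support (t : term Delta) :
  exists N, forall (A : Type) (ops : operations Delta A) (h h' : nat -> A),
    (forall n, (n < N)%N -> h n = h' n) -> term_eval ops h t = term_eval ops h' t.
Proof.
elim: t => [m|o ts IH]; first by exists m.+1 => A ops h h'; exact.
have [N HN] := choice IH; exists (\max_k N k)%N => A ops h h' hh' /=.
congr (ops o _); apply/funext => k; apply: HN => n nN; apply: hh'.
by apply: leq_trans nN _; exact: leq_bigmax.
Qed.

Lemma scott_continuous_term_eval (d : Order.disp_t) (A : porderType d)
    (ops : operations Delta A) (h : nat -> A) (n : nat) (t : term Delta) :
  scott_continuous_operations ops ->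
  scott_continuous (fun x => term_eval ops (dfwith h n x) t).
Proof.
move=> opsc; elim: t => [m|o ts IH] /=.
  have [->|nm] := eqVneq n m.
    have -> : (fun x => dfwith h m x m) = id by apply/funext => x; rewrite dfwithin.
    exact: scott_continuous_id.
  have -> : (fun x => dfwith h n x m) = cst (h m).
    by apply/funext => x; rewrite dfwithout.
  exact: scott_continuous_cst.
exact: (scott_continuous_comp (opsc o) (scott_continuous_pointwise IH)).
Qed.

End Terms.

(* A term mentions finitely many variables, so the remaining ones may be sent to
   a point of [X] before inducting on the others one at a time. *)
Lemma completion_satisfies (Delta : signature) (E : set (inequality Delta))
    (X : topologicalType) (ops : operations Delta X)
    (opsT : operations Delta (D_completion X)) :
  scott_continuous_extension ops opsT -> satisfies (@specialization X) ops E ->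
  satisfies (@ple _ (D_completion X)) opsT E.
Proof.
move=> [opsTc opsTh] opsE p Ep h.
have [N1 HN1] := term_eval_finite_support p.1.
have [N2 HN2] := term_eval_finite_support p.2.
have [x _] := Gamma_nonempty (val (h 0%N)).
pose h' n := if (n < maxn N1 N2)%N then h n else eta_map x.
have e1 : term_eval opsT h p.1 = term_eval opsT h' p.1.
  by apply: HN1 => n nN; rewrite /h' leq_max nN.
have e2 : term_eval opsT h p.2 = term_eval opsT h' p.2.
  by apply: HN2 => n nN; rewrite /h' leq_max nN orbT.
rewrite e1 e2.
apply: (completion_ind_seq
  (S := [set h | term_eval opsT h p.1 <= term_eval opsT h p.2])
  (s := iota 0 (maxn N1 N2))) => [u|u k|k].
- by rewrite /= !(term_eval_homomorphism _ _ opsTh); apply/eta_homo/opsE.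
- by apply: d_closed_le; exact: scott_continuous_term_eval.
- by rewrite mem_iota add0n /h' /= => /negbTE ->; exists x.
Qed.

(** Applying [g] after an operation or before it gives maps that are Scott continuous in each
    argument and agree on tuples from [X]; uniqueness of extensions identifies them. *)
Lemma homomorphism_completion (Delta : signature) (X : topologicalType)
    (ops : operations Delta X) (opsT : operations Delta (D_completion X))
    (d : Order.disp_t) (B : porderType d) (opsB : operations Delta B)
    (g : D_completion X -> B) :
  scott_continuous_extension ops opsT -> scott_continuous_operations opsB ->
  scott_continuous g -> homomorphism ops opsB (g \o @eta_map X) ->
  homomorphism opsT opsB g.
Proof.
move=> [opsTc opsTh] opsBc gc gh o t.
suff : g \o opsT o = opsB o \o (fun u k => g (u k)) by move/(congr1 (@^~ t)).
apply: completion_extension_unique_fin => [u k|u k|u /=].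
- apply: scott_continuous_comp gc _.
  exact: (scott_continuous_comp (opsTc o) (scott_continuous_dfwith u k)).
- have dc := scott_continuous_comp (opsBc o)
    (scott_continuous_dfwith (fun j => g (u j)) k).
  have -> : (fun x => (opsB o \o (fun u j => g (u j))) (dfwith u k x)) =
      (opsB o \o dfwith (fun j => g (u j)) k) \o g.
    by apply/funext => x /=; rewrite comp_dfwith.
  exact: scott_continuous_comp dc gc.
- by rewrite -opsTh -gh.
Qed.

(** * Freeness of the completed algebra *)

Theorem theorem4p4 (d : Order.disp_t) (L : porderType d) (hL : dcpo L)
    (Delta : signature) (E : set (inequality Delta))
    (F : topologicalType) (ops : operations Delta F) (i : scott L -> F)
    (hF : free_dtop_algebra E ops i) :
  exists opsT : operations Delta (D_completion F),
    unique (scott_continuous_extension ops) opsT /\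
    free_dcpo_algebra E opsT (fun x : L => eta_map (i x)).
Proof.
have [[Fdir opsc opsE] ic univ] := hF.
pose opsT : operations Delta (D_completion F) := fun o => lift_operation (opsc o).
have ext : scott_continuous_extension ops opsT.
  split=> o; first exact: scott_continuous_lift_operation.
  by move=> t; rewrite /opsT lift_operation_eta.
have etac := eta_continuous Fdir.
exists opsT; split; first split=> // ops' [opsc' opsh'].
  (* Any other extension is Scott continuous in each argument and takes the same values on principal
     down-sets. *)
  apply: functional_extensionality_dep => o.
  apply: completion_extension_unique_fin => [t k|t k|t].
  - exact: (scott_continuous_comp (ext.1 o) (scott_continuous_dfwith t k)).
  - exact: (scott_continuous_comp (opsc' o) (scott_continuous_dfwith t k)).
  - by rewrite -ext.2 -opsh'.
split.
- split; [exact: completion_dcpo|exact: ext.1|exact: completion_satisfies opsE].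
- by apply/scott_continuousP => x; exact: continuous_comp (ic x) (etac _).
move=> d' B opsB f hB /scott_continuousP fc.
(* Freeness is applied to [B] with its Scott topology; the resulting [g] then extends to [gT]. *)
have [g [[gc gh gi] guniq]] := univ (scott B) opsB f (dcpo_dtop_algebra hB) fc.
have [Bdcpo opsBc _] := hB.
have [gT gTc gTeta] := completion_extension Bdcpo gc.
exists gT; split=> [|g' [g'c g'h g'i]].
  split=> //; last by rewrite -gi; apply/funext => x /=; exact: gTeta.
  apply: (homomorphism_completion ext) => // o t /=.
  by rewrite gTeta gh; congr (opsB o _); apply/funext => k; rewrite gTeta.
apply: completion_extension_unique => // x; rewrite gTeta.
(* Composing a competitor [g'] with [eta_map] gives a continuous homomorphism extending [f], which
   is [g] by freeness; hence [g'] and [gT] agree on principal down-sets. *)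
rewrite (guniq (g' \o @eta_map F : F -> scott B))//; split=> [|o t|//].
- move=> y; apply: continuous_comp (etac y) _.
  by have /scott_continuousP := g'c; apply.
- by rewrite /= ext.2 g'h.
Qed.
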